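(* (Cut elimination for $\mathrm{SLT}_{\omega}$.) The rule (cut) is admissible in cut-free $\mathrm{SLT}_{\omega}$: for every sequent $\Gamma \Rightarrow \gamma$, if $\Gamma \Rightarrow \gamma$ is derivable in $\mathrm{SLT}_{\omega}$, then $\Gamma \Rightarrow \gamma$ is derivable in $\mathrm{SLT}_{\omega}$ without any application of (cut).
   Context: Formulas are built from countably many propositional variables $p,q,\dots$ using the binary connectives $\to,\wedge,\vee$ and the unary connectives $\neg$, $\mathrm{G}$, $\mathrm{F}$, $\mathrm{X}$. For $i\in\omega$, $\mathrm{X}^0\alpha := \alpha$ and $\mathrm{X}^{n+1}\alpha := \mathrm{X}^n\mathrm{X}\alpha$. Greek capitals $\Gamma,\Sigma$ denote finite (possibly empty) sets of formulas, and a comma denotes set union. A sequent of $\mathrm{SLT}_{\omega}$ is an expression $\Gamma \Rightarrow \gamma$ where $\gamma$ is a single formula or empty. Derivations are well-founded, possibly infinitely branching trees built from the following, where $i,k$ are arbitrary natural numbers, $p$ a propositional variable, $\gamma$ a formula or empty: Initial sequents: $\mathrm{X}^i p, \Gamma \Rightarrow \mathrm{X}^i p$. (cut): from $\Gamma\Rightarrow\alpha$ and $\alpha,\Sigma\Rightarrow\gamma$ infer $\Gamma,\Sigma\Rightarrow\gamma$. (we-right): from $\Gamma\Rightarrow$ infer $\Gamma\Rightarrow\alpha$. ($\to$left): from $\Gamma\Rightarrow \mathrm{X}^i\alpha$ and $\mathrm{X}^i\beta,\Gamma\Rightarrow\gamma$ infer $\mathrm{X}^i(\alpha\to\beta),\Gamma\Rightarrow\gamma$.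 ($\to$right): from $\mathrm{X}^i\alpha,\Gamma\Rightarrow\mathrm{X}^i\beta$ infer $\Gamma\Rightarrow\mathrm{X}^i(\alpha\to\beta)$. ($\neg$left): from $\Gamma\Rightarrow\mathrm{X}^i\alpha$ infer $\mathrm{X}^i\neg\alpha,\Gamma\Rightarrow$ (empty succedent). ($\neg$right): from $\mathrm{X}^i\alpha,\Gamma\Rightarrow$ infer $\Gamma\Rightarrow\mathrm{X}^i\neg\alpha$. (ex-middle): from $\mathrm{X}^i\neg\alpha,\Gamma\Rightarrow\gamma$ and $\mathrm{X}^i\alpha,\Gamma\Rightarrow\gamma$ infer $\Gamma\Rightarrow\gamma$. ($\wedge$left): from $\mathrm{X}^i\alpha,\mathrm{X}^i\beta,\Gamma\Rightarrow\gamma$ infer $\mathrm{X}^i(\alpha\wedge\beta),\Gamma\Rightarrow\gamma$. ($\wedge$right): from $\Gamma\Rightarrow\mathrm{X}^i\alpha$ and $\Gamma\Rightarrow\mathrm{X}^i\beta$ infer $\Gamma\Rightarrow\mathrm{X}^i(\alpha\wedge\beta)$. ($\vee$left): from $\mathrm{X}^i\alpha,\Gamma\Rightarrow\gamma$ and $\mathrm{X}^i\beta,\Gamma\Rightarrow\gamma$ infer $\mathrm{X}^i(\alpha\vee\beta),\Gamma\Rightarrow\gamma$. ($\vee$right1)/($\vee$right2): from $\Gamma\Rightarrow\mathrm{X}^i\alpha$ (resp. $\Gamma\Rightarrow\mathrm{X}^i\beta$) infer $\Gamma\Rightarrow\mathrm{X}^i(\alpha\vee\beta)$. (Gleft): from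 $\mathrm{X}^{i+k}\alpha,\Gamma\Rightarrow\gamma$ infer $\mathrm{X}^i\mathrm{G}\alpha,\Gamma\Rightarrow\gamma$. (Gright): from all $\Gamma\Rightarrow\mathrm{X}^{i+j}\alpha$ for $j\in\omega$ infer $\Gamma\Rightarrow\mathrm{X}^i\mathrm{G}\alpha$. (Fleft): from all $\mathrm{X}^{i+j}\alpha,\Gamma\Rightarrow\gamma$ for $j\in\omega$ infer $\mathrm{X}^i\mathrm{F}\alpha,\Gamma\Rightarrow\gamma$. (Fright): from $\Gamma\Rightarrow\mathrm{X}^{i+k}\alpha$ infer $\Gamma\Rightarrow\mathrm{X}^i\mathrm{F}\alpha$. Cut-free $\mathrm{SLT}_{\omega}$ is the system without (cut). *)

(* Defs.v *)
From HB Require Import structures.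
From mathcomp Require Import all_boot finmap.

Set Implicit Arguments.
Unset Strict Implicit.
Unset Printing Implicit Defensive.

Local Open Scope fset_scope.

Inductive form : Type :=
| Var of nat
| Imp of form & form
| And of form & form
| Or of form & form
| Neg of form
| Glob of form
| Fut of form
| Next of form.

(* Encoding into generic trees; it only serves to give [form] the choice
   structure that finite sets {fset form} require. *)
Fixpoint form_code (a : form) : GenTree.tree nat :=
  match a with
  | Var p => GenTree.Leaf p
  | Imp a b => GenTree.Node 0 [:: form_code a; form_code b]
  | And a b => GenTree.Node 1 [:: form_code a; form_code b]
  | Or a b => GenTree.Node 2 [:: form_code a; form_code b]
  | Neg a => GenTree.Node 3 [:: form_code a]
  | Glob a => GenTree.Node 4 [:: form_code a]
  | Fut a => GenTree.Node 5 [:: form_code a]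
  | Next a => GenTree.Node 6 [:: form_code a]
  end.

Fixpoint form_decode (t : GenTree.tree nat) : form :=
  match t with
  | GenTree.Leaf p => Var p
  | GenTree.Node 0 [:: a; b] => Imp (form_decode a) (form_decode b)
  | GenTree.Node 1 [:: a; b] => And (form_decode a) (form_decode b)
  | GenTree.Node 2 [:: a; b] => Or (form_decode a) (form_decode b)
  | GenTree.Node 3 [:: a] => Neg (form_decode a)
  | GenTree.Node 4 [:: a] => Glob (form_decode a)
  | GenTree.Node 5 [:: a] => Fut (form_decode a)
  | GenTree.Node 6 [:: a] => Next (form_decode a)
  | _ => Var 0
  end.

Lemma form_codeK : cancel form_code form_decode.
Proof.
by elim=> //= [a -> b ->|a -> b ->|a -> b ->|a ->|a ->|a ->|a ->].
Qed.

HB.instance Definition _ := Countable.copy form (can_type form_codeK).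

Fixpoint Xn (n : nat) (a : form) : form :=
  if n is m.+1 then Xn m (Next a) else a.

(* [derivable c G g] : the sequent G => g has a well-founded derivation, in
   which (cut) may be used only if [c] is true.  The succedent [None] is the
   empty one.  Antecedents are sets, so in a rule with conclusion [a |` G] the
   principal formula [a] may already belong to [G]. *)
Inductive derivable (c : bool) : {fset form} -> option form -> Prop :=
| d_init i p G :
    derivable c (Xn i (Var p) |` G) (Some (Xn i (Var p)))
| d_cut a G S g :
    c ->
    derivable c G (Some a) -> derivable c (a |` S) g ->
    derivable c (G `|` S) g
| d_weR a G :
    derivable c G None -> derivable c G (Some a)
| d_ImpL i a b G g :
    derivable c G (Some (Xn i a)) -> derivable c (Xn i b |` G) g ->
    derivable c (Xn i (Imp a b) |` G) g
| d_ImpR i a b G :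
    derivable c (Xn i a |` G) (Some (Xn i b)) ->
    derivable c G (Some (Xn i (Imp a b)))
| d_NegL i a G :
    derivable c G (Some (Xn i a)) -> derivable c (Xn i (Neg a) |` G) None
| d_NegR i a G :
    derivable c (Xn i a |` G) None -> derivable c G (Some (Xn i (Neg a)))
| d_exmid i a G g :
    derivable c (Xn i (Neg a) |` G) g -> derivable c (Xn i a |` G) g ->
    derivable c G g
| d_AndL i a b G g :
    derivable c (Xn i a |` (Xn i b |` G)) g ->
    derivable c (Xn i (And a b) |` G) g
| d_AndR i a b G :
    derivable c G (Some (Xn i a)) -> derivable c G (Some (Xn i b)) ->
    derivable c G (Some (Xn i (And a b)))
| d_OrL i a b G g :
    derivable c (Xn i a |` G) g -> derivable c (Xn i b |` G) g ->
    derivable c (Xn i (Or a b) |` G) g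
| d_OrR1 i a b G :
    derivable c G (Some (Xn i a)) -> derivable c G (Some (Xn i (Or a b)))
| d_OrR2 i a b G :
    derivable c G (Some (Xn i b)) -> derivable c G (Some (Xn i (Or a b)))
| d_GlobL i k a G g :
    derivable c (Xn (i + k) a |` G) g -> derivable c (Xn i (Glob a) |` G) g
| d_GlobR i a G :
    (forall j, derivable c G (Some (Xn (i + j) a))) ->
    derivable c G (Some (Xn i (Glob a)))
| d_FutL i a G g :
    (forall j, derivable c (Xn (i + j) a |` G) g) ->
    derivable c (Xn i (Fut a) |` G) g
| d_FutR i k a G :
    derivable c G (Some (Xn (i + k) a)) -> derivable c G (Some (Xn i (Fut a))).

Definition SLT : {fset form} -> option form -> Prop := derivable true.
Definition SLT_cutfree : {fset form} -> option form -> Prop := derivable false.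

(* Main.v *)
Require Import Defs.
From mathcomp Require Import all_boot finmap.

(** Excluded middle on the cut formula [a] replaces the cut: the premise
    [G => a] yields [Neg a, G =>] by the left rule for negation, and the other
    premise is [a, S => g].  Weakening gives both the context [G, S]. *)

Local Open Scope fset_scope.

(** Every rule leaves its side context arbitrary, so [D] can be carried through the whole tree,
    infinite branchings included. *)
Lemma derivable_weakening (c : bool) (G D : {fset form}) (g : option form) :
  derivable c G g -> derivable c (G `|` D) g.
Proof.
elim=> {G g} [i p G|a G S g cT _ IH1 _ IH2|a G _ IH|i a b G g _ IH1 _ IH2
  |i a b G _ IH|i a G _ IH|i a G _ IH|i a G g _ IH1 _ IH2|i a b G g _ IH
  |i a b G _ IH1 _ IH2|i a b G g _ IH1 _ IH2|i a b G _ IH|i a b G _ IH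
  |i k a G g _ IH|i a G _ IH|i a G g _ IH|i k a G _ IH].
- by rewrite -fsetUA; apply: d_init.
(* Idempotence doubles [D], giving each premise of the cut its own copy. *)
- rewrite -[D]fsetUid fsetUACA; apply: (d_cut cT IH1).
  by rewrite fsetUA.
- exact: d_weR.
- by rewrite -fsetUA; apply: d_ImpL; rewrite ?fsetUA.
- by apply: d_ImpR; rewrite fsetUA.
- by rewrite -fsetUA; apply: d_NegL.
- by apply: d_NegR; rewrite fsetUA.
- by apply: (@d_exmid c i a); rewrite fsetUA.
- by rewrite -fsetUA; apply: d_AndL; rewrite -!fsetUA in IH.
- exact: d_AndR.
- by rewrite -fsetUA; apply: d_OrL; rewrite fsetUA.
- exact: d_OrR1.
- exact: d_OrR2.
- by rewrite -fsetUA; apply: (@d_GlobL c i k); rewrite fsetUA.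
- exact: d_GlobR.
- by rewrite -fsetUA; apply: d_FutL => j; rewrite fsetUA.
- exact: d_FutR IH.
Qed.

Lemma cut_admissible (c : bool) (a : form) (G S : {fset form})
    (g : option form) :
  derivable c G (Some a) -> derivable c (a |` S) g ->
  derivable c (G `|` S) g.
Proof.
(* With exponent 0, [Xn 0 a] is [a] itself, whatever its shape. *)
move=> dG dS; apply: (@d_exmid c 0 a) => /=.
  have dN : derivable c (Neg a |` (G `|` S)) None.
    by apply: (@d_NegL c 0 a); apply: derivable_weakening.
  (* Left negation yields only an empty succedent; [d_weR] fills it when [g] is a formula. *)
  by case: g dS => [b|] _ //; apply: d_weR.
by rewrite [G `|` S]fsetUC fsetUA; apply: derivable_weakening.
Qed.

Theorem theorem1 (G : {fset form}) (g : option form) :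
  SLT G g -> SLT_cutfree G g.
Proof.
rewrite /SLT /SLT_cutfree.
elim=> {G g} [i p G|a G S g _ _ IH1 _ IH2|a G _ IH|i a b G g _ IH1 _ IH2
  |i a b G _ IH|i a G _ IH|i a G _ IH|i a G g _ IH1 _ IH2|i a b G g _ IH
  |i a b G _ IH1 _ IH2|i a b G g _ IH1 _ IH2|i a b G _ IH|i a b G _ IH
  |i k a G g _ IH|i a G _ IH|i a G g _ IH|i k a G _ IH].
- exact: d_init.
(* Both premises are cut-free by induction, and replacing the cut by excluded middle creates no new
   cut. *)
- exact: cut_admissible IH1 IH2.
- exact: d_weR.
- exact: d_ImpL.
- exact: d_ImpR.
- exact: d_NegL.
- exact: d_NegR.
- exact: d_exmid IH1 IH2.
- exact: d_AndL.
- exact: d_AndR.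
- exact: d_OrL.
- exact: d_OrR1.
- exact: d_OrR2.
- exact: d_GlobL IH.
- exact: d_GlobR.
- exact: d_FutL.
- exact: d_FutR IH.
Qed.
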